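(* Let $1\le m\le n$ be integers. There is a bijection between $\mathscr C(m,n)$ and $\mathscr F(n+1,n+1-m)$.
   Context: For $\vec r=(r_1,\dots,r_n)$ a vector of nonnegative integers and $\sigma\in\mathfrak S_m$, the pair $(\vec r,\sigma)$ is called compatible if for every $k\in\{1,\dots,n\}$ the values $1+\sum_{i=1}^{k-1}r_i,\dots,\sum_{i=1}^k r_i$ appear from left to right in the word $\sigma=\sigma_1\sigma_2\cdots\sigma_m$; $\vec r$ is called balanced if there exist integers $0=:k_0<k_1<\dots<k_{n-m}<k_{n-m+1}:=n+1$ such that $\sum_{s=1}^{k_i}r_s=k_i-i$ for all $1\le i\le n-m$, $\sum_{s=1}^j r_s>j-i-1$ for all $k_i<j<k_{i+1}$ and $0\le i\le n-m$, and $\sum_{s=1}^n r_s=m$. $\mathscr C(m,n)$ is the set of compatible pairs $(\vec r,\sigma)$ with $\vec r$ balanced. $\mathscr F(n+1,n+1-m)$ denotes the set of spanning forests on $n+1$ labeled vertices consisting of exactly $n+1-m$ trees, where a fixed specified set of $n+1-m$ vertices are the roots of the different trees (each tree contains exactly one of them). *)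

(* Defs.v *)
From mathcomp Require Import all_boot all_fingroup.
From mathcomp Require Import classical_sets functions.

Set Implicit Arguments.
Unset Strict Implicit.
Unset Printing Implicit Defensive.

(* A vector (r_1, ..., r_n) is a function on 'I_n, with r_i stored at index
   i - 1; thus [psum r k] is r_1 + ... + r_k (for k <= n). *)
Definition psum n (r : {ffun 'I_n -> nat}) (k : nat) : nat :=
  \sum_(s < n | s < k) r s.

(* The one-line word of a permutation, with letters in {1, ..., m}. *)
Definition word m (sigma : 'S_m) : seq nat :=
  [seq (nat_of_ord (sigma i)).+1 | i <- enum 'I_m].

Definition compatible n m (r : {ffun 'I_n -> nat}) (sigma : 'S_m) : Prop :=
  forall k : 'I_n, subseq (iota (psum r k).+1 (r k)) (word sigma).

(* Only the values k 0, ..., k (n - m).+1 matter. Since k is strictly increasing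
   there and k 0 = 0, one has i <= k i, so for m <= n no subtraction below is
   truncated. *)
Definition balanced n (m : nat) (r : {ffun 'I_n -> nat}) : Prop :=
  exists k : nat -> nat,
    [/\ [/\ k 0 = 0, k (n - m).+1 = n.+1
          & forall i, i <= n - m -> k i < k i.+1],
        forall i, 1 <= i <= n - m -> psum r (k i) = k i - i,
        forall i j, i <= n - m -> k i < j < k i.+1 -> psum r j > j - i - 1
      & psum r n = m].

Definition compatible_balanced (m n : nat) : set ({ffun 'I_n -> nat} * 'S_m) :=
  [set x | compatible x.1 x.2 /\ balanced m x.1]%classic.

Arguments compatible_balanced : clear implicits.

Section Graph.
Variable V : finType.
Implicit Type E : {set {set V}}.

Definition simple_graph E : Prop := forall e, e \in E -> #|e| = 2.

Definition adj E : rel V := fun x y => [set x; y] \in E.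

(* A [ucycle] of size 2 only runs back and forth along one edge. *)
Definition acyclic E : Prop := forall c : seq V, ucycle (adj E) c -> size c <= 2.

Definition rooted_forest (t : nat) (R : {set V}) E : Prop :=
  [/\ simple_graph E, acyclic E, n_comp (adj E) predT = t
    & forall x, #|[set y in R | connect (adj E) x y]| = 1].

Definition rooted_forests (t : nat) (R : {set V}) : set {set {set V}} :=
  [set E | rooted_forest t R E]%classic.
End Graph.

(* Main.v *)
(* The pair (r, sigma) is read as a breadth-first search. Let t = n + 1 - m, and
   put in a queue the t roots followed by the letters 1, ..., m in the order
   sigma^-1(1), sigma^-1(2), ...; block k, that is the values
   r_1 + ... + r_(k-1) < v <= r_1 + ... + r_k, lists the children of the k-th
   vertex of the queue. Balanced means r_1 + ... + r_j >= j - (n - m) for all j: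
   the queue never runs empty, so each vertex comes after its parent and the
   parent map is acyclic. Compatible means that siblings enter the queue in
   increasing order, so that the queue order is determined by the parent map.
   Conversely the queue order of a given forest is the shortlex order of the paths
   from the roots. *)
Require Import Defs.
From mathcomp Require Import all_boot all_fingroup.
From mathcomp Require Import classical_sets functions.
From mathcomp Require Import zify.

Set Implicit Arguments.
Unset Strict Implicit.
Unset Printing Implicit Defensive.

(** * Rooted forests and parent maps *)

Section ParentMaps.
Variables (V : finType) (R : {set V}).
Implicit Types (E : {set {set V}}) (g : V -> V) (h : V -> nat) (x y : V).

(** A height certifying that iterating the parent map [g] from any vertex ends in [R]. *)
Definition ranked g h := forall x, x \notin R -> h (g x) < h x.

Definition edges g : {set {set V}} := [set [set x; g x] | x in ~: R].

Lemma adj_sym E : symmetric (adj E).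
Proof. by move=> x y; rewrite /adj finset.setUC. Qed.

Lemma adj_edgesP g x y :
  reflect ((x \notin R /\ y = g x) \/ (y \notin R /\ x = g y)) (adj (edges g) x y).
Proof.
apply: (iffP imsetP) => [[z]|[[xR ->]|[yR ->]]]; last 2 first.
- by exists x; rewrite ?inE.
- by exists y; rewrite ?inE // finset.setUC.
rewrite inE => zR exy.
have : z \in [set x; y] by rewrite exy !inE eqxx.
have : g z \in [set x; y] by rewrite exy !inE eqxx orbT.
have : x \in [set z; g z] by rewrite -exy !inE eqxx.
have : y \in [set z; g z] by rewrite -exy !inE eqxx orbT.
rewrite !inE => /orP[]/eqP ? /orP[]/eqP ? /orP[]/eqP ? /orP[]/eqP ?; subst; auto;
  by left; split; congruence.
Qed.

Lemma edges_simple g h : ranked g h -> simple_graph (edges g).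
Proof.
move=> rk e /imsetP[x]; rewrite inE => xR ->; rewrite cards2.
by case: eqP => // ex; have := rk x xR; rewrite -ex ltnn.
Qed.

(** At a highest vertex of a cycle both neighbours must be its parent, so they coincide, and a
    repetition-free cycle then has at most two vertices. *)
Lemma edges_acyclic g h : ranked g h -> acyclic (edges g).
Proof.
move=> rk [//|x0 c0] uc; set c := x0 :: c0 in uc *.
have x0c : x0 \in c by rewrite inE eqxx.
pose x := [arg max_(x > x0 in c) h x].
have [xc xmax] : x \in c /\ forall y, y \in c -> h y <= h x.
  by rewrite /x; case: arg_maxnP => // i ? ?; split.
have [i p rp] := rot_to xc.
have up y : y \in c -> adj (edges g) x y -> y = g x.
  move=> yc /adj_edgesP[[]//|[yR ex]].
  by have := rk y yR; rewrite -ex ltnNge xmax.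
have memc y : y \in x :: p -> y \in c by rewrite -rp mem_rot.
rewrite -(size_rot i) rp; move: uc; rewrite -(rot_ucycle i) rp.
case: p memc {rp} => [|a p] // memc /andP[].
rewrite /= rcons_path => /and3P[xa _ lx] /and3P[_ ap _].
have ea : a = g x by apply: up xa; apply: memc; rewrite !inE eqxx orbT.
have el : last a p = g x.
  by apply: up; [apply: memc; rewrite inE mem_last orbT | rewrite adj_sym].
case: p ap {lx} el {memc} => [|b p] //= /negP ap el; case: ap; rewrite ea -el.
exact: mem_last.
Qed.

Lemma ranked_root g h x :
  ranked g h -> exists2 y, y \in R & connect (adj (edges g)) x y.
Proof.
move=> rk; have [k] := ubnP (h x); elim: k x => // k IH x hx.
have [xR|xR] := boolP (x \in R); first by exists x.
have [|y yR cy] := IH (g x); first by have := rk x xR; lia.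
exists y => //; apply: connect_trans cy; apply: connect1.
by apply/adj_edgesP; left.
Qed.

(** The map sending a vertex to the root above it is constant along edges, hence on components, and
    it fixes every root. *)
Lemma edges_root_uniq g h : ranked g h ->
  {in R &, forall y z, connect (adj (edges g)) y z -> y = z}.
Proof.
move=> rk y z yR zR.
pose g0 x := if x \in R then x else g x.
(* [B] bounds all heights, so [B] iterations reach [R] from anywhere; [g0] makes the roots
   absorbing. *)
pose B := \max_x h x; pose rho x := iter B g0 x.
have itR k x : x \in R -> iter k g0 x = x.
  by move=> xR; elim: k => //= k ->; rewrite /g0 xR.
have rhoR k x : h x <= k -> iter k g0 x \in R.
  elim: k x => [|k IH] x hx.
    by case: (boolP (x \in R)) => // xR; have := rk x xR; lia.
  rewrite iterSr; have [xR|xR] := boolP (x \in R).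
    by rewrite {2}/g0 xR itR.
  by apply: IH; rewrite /g0 (negPf xR); have := rk x xR; lia.
have rho_g x : x \notin R -> rho (g x) = rho x.
  move=> xR; have -> : g x = g0 x by rewrite /g0 (negPf xR).
  by rewrite /rho -iterSr /= {1}/g0 rhoR // leq_bigmax.
have rho_adj x w : adj (edges g) x w -> rho x = rho w.
  by case/adj_edgesP=> [[? ->]|[? ->]]; rewrite rho_g.
suff: connect (adj (edges g)) y z -> rho y = rho z by rewrite /rho !itR.
case/connectP=> p; elim: p y {yR} => [y _ -> //|a p IH] y /= /andP[ya pa] ez.
by rewrite (rho_adj _ _ ya); apply: IH.
Qed.

(** Taking canonical representatives is a bijection from [R] onto the representatives of all
    components. *)
Lemma n_comp_roots E :
  (forall x, #|[set y in R | connect (adj E) x y]| = 1) ->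
  n_comp (adj E) predT = #|R|.
Proof.
move=> one; have csym := sym_connect_sym (adj_sym E).
have inj : {in R &, injective (fingraph.root (adj E))}.
  move=> y z yR zR /eqP; rewrite root_connect // => yz.
  have /eqP/cards1P[w ew] := one y.
  have : y \in [set w] by rewrite -ew !inE yR connect0.
  have : z \in [set w] by rewrite -ew !inE zR.
  by rewrite !inE => /eqP -> /eqP.
rewrite -(card_in_imset inj); apply: eq_card => x; rewrite !inE andbT.
apply/idP/imsetP=> [/eqP xx|[y yR ->]]; last exact: roots_root.
have /eqP/cards1P[w ew] := one x.
have /[!inE]/andP[wR xw] : w \in [set y in R | connect (adj E) x y].
  by rewrite ew inE.
by exists w => //; rewrite -xx; apply/eqP; rewrite root_connect.
Qed.

Lemma edges_forest g h : ranked g h -> rooted_forest #|R| R (edges g).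
Proof.
move=> rk.
have one x : #|[set y in R | connect (adj (edges g)) x y]| = 1.
  have [y yR xy] := ranked_root x rk.
  apply/eqP/cards1P; exists y; apply/setP=> z; rewrite !inE.
  apply/andP/eqP=> [[zR xz]|->]; last by split.
  apply: (edges_root_uniq rk) => //; apply: connect_trans xy.
  by rewrite (sym_connect_sym (adj_sym _)).
split=> //; [exact: edges_simple rk | exact: edges_acyclic rk |].
exact: n_comp_roots.
Qed.

(** Induction on height. The edge from [x] to [g x] also comes from [g']; if [x] were the
    [g']-parent of [g x], then by induction it would be its [g]-parent as well, against the
    heights. *)
Lemma edges_inj g h g' h' :
  ranked g h -> ranked g' h' -> edges g = edges g' -> {in ~: R, g =1 g'}.
Proof.
move=> rk rk' eE x; rewrite inE.
have [k] := ubnP (h x); elim: k x => // k IH x hx xR.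
have : adj (edges g') x (g x) by rewrite -eE; apply/adj_edgesP; left.
case/adj_edgesP=> [[]//|[gxR ex]].
have := rk _ gxR; rewrite IH //; last by have := rk x xR; lia.
by rewrite -ex; have := rk x xR; lia.
Qed.

(* Otherwise the edge would close an E'-path from x to y into a cycle. *)
Lemma acyclic_subset_edge E E' x y : acyclic E -> simple_graph E ->
  subrel (adj E') (adj E) -> adj E x y -> connect (adj E') x y -> adj E' x y.
Proof.
move=> acE sE sub xy /connectP[p0 /shortenP[p pp up _] ey].
have : size (x :: p) <= 2.
  apply: acE; rewrite /ucycle up andbT (cycle_path x) /= -ey adj_sym xy.
  exact: sub_path pp.
case: p pp ey {up} => [|a []] //=; last by move=> /andP[? _] ->.
by move=> _ ex; move: (sE _ xy); rewrite ex finset.setUid cards1.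
Qed.

(** The height is the distance to [R], and the parent is a neighbour closer to [R]. No edge of [E]
    is lost: its endpoints have the same root, so parent edges already connect them, and acyclicity
    applies. *)
Lemma forest_edges t E :
  rooted_forest t R E -> exists g h, ranked g h /\ E = edges g.
Proof.
case=> sE aE _ one.
pose reach x k := [exists p : k.-tuple V, path (adj E) x p && (last x p \in R)].
have ex_reach x : exists k, reach x k.
  have /eqP/cards1P[w ew] := one x.
  have /[!inE]/andP[wR /connectP[p pp ep]] : w \in [set y in R | connect (adj E) x y].
    by rewrite ew inE.
  by exists (size p); apply/existsP; exists (in_tuple p); rewrite /= pp -ep.
pose h x := ex_minn (ex_reach x).
have next x : x \notin R -> exists y, adj E x y && (h y < h x).
  move=> xR; rewrite {2}/h; case: ex_minnP => -[|k] /existsP[[p /= /eqP sp]] /andP[pp lp] _.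
    by case: p sp pp lp => //= _ _; rewrite (negPf xR).
  case: p sp pp lp => //= y p [sp] /andP[xy py] lp; exists y; rewrite xy /= ltnS.
  rewrite /h; case: ex_minnP => l _; apply; apply/existsP.
  by exists (tcast sp (in_tuple p)); rewrite val_tcast /= py.
(* The default [x] is taken only at roots, which are at distance 0. *)
pose g x := odflt x [pick y | adj E x y && (h y < h x)].
have gP x : x \notin R -> adj E x (g x) /\ h (g x) < h x.
  move=> /next[y yP]; rewrite /g; case: pickP => [z /andP[]//|/(_ y)].
  by rewrite yP.
have rk : ranked g h by move=> x /gP[].
have sub : subrel (adj (edges g)) (adj E).
  by move=> x y /adj_edgesP[[/gP[? _] ->]|[/gP[? _] ->]] //; rewrite adj_sym.
exists g, h; split=> //; apply/setP=> e; apply/idP/imsetP=> [eE|[x]]; last first.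
  by rewrite inE => /gP[? _] ->.
have /eqP/cards2P[x [y [xy exy]]] := sE e eE.
have Exy : adj E x y by rewrite /adj -exy.
suff /imsetP[z zR ez] : adj (edges g) x y by exists z; rewrite // exy.
apply: (acyclic_subset_edge aE sE sub Exy).
have [v vR xv] := ranked_root x rk; have [w wR yw] := ranked_root y rk.
apply: (connect_trans xv); rewrite (sym_connect_sym (adj_sym _)).
suff -> : v = w by [].
have /eqP/cards1P[u eu] := one x.
have cE := connect_sub (fun a b ab => connect1 (sub a b ab)).
have : v \in [set u] by rewrite -eu inE vR cE.
have : w \in [set u] by rewrite -eu inE wR (connect_trans (connect1 Exy)) ?cE.
by rewrite !inE => /eqP -> /eqP.
Qed.
End ParentMaps.

(** * Blocks, balanced vectors and compatible permutations *)

Section Blocks.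
Variable n : nat.
Implicit Types (r : {ffun 'I_n -> nat}) (i j k q : nat).

Lemma psum0 r : psum r 0 = 0.
Proof. by rewrite /psum big_pred0. Qed.

Lemma psumS r (k : 'I_n) : psum r k.+1 = psum r k + r k.
Proof.
rewrite /psum (bigD1 k) //= addnC; congr (_ + _); apply: eq_bigl => s.
by rewrite ltnS ltn_neqAle andbC.
Qed.

Lemma leq_psum r : {homo psum r : j k / j <= k}.
Proof.
move=> j k jk; rewrite /psum big_mkcond [leqRHS]big_mkcond; apply: leq_sum => s _.
by case: ltnP => // sj; rewrite (leq_trans sj jk).
Qed.

(* Block indices and the values in blocks are counted from 0 here. *)
Definition blk r q : nat := find (fun k => q < psum r k.+1) (iota 0 n).

Lemma blkP r q : q < psum r n ->
  [/\ blk r q < n, psum r (blk r q) <= q & q < psum r (blk r q).+1].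
Proof.
move=> qn; set a := fun k => q < psum r k.+1.
have n_gt0 : 0 < n.
  rewrite ltnNge; apply/negP => n0.
  by have := leq_psum r n0; rewrite psum0; lia.
have ha : has a (iota 0 n).
  by apply/hasP; exists n.-1; rewrite ?mem_iota /a; [lia | rewrite prednK].
have := ha; rewrite has_find size_iota => bn; split=> //; last first.
  by have := nth_find 0 ha; rewrite nth_iota.
rewrite -/(blk r q) in bn *; case e: (blk r q) => [|b]; first by rewrite psum0.
have : b < find a (iota 0 n) by rewrite -/(blk r q) e.
by move/(before_find 0); rewrite nth_iota ?add0n /a; lia.
Qed.

(** An adjunction between [blk] and [psum], through which each determines the other. *)
Lemma blk_lt r q k : q < psum r n -> (blk r q < k) = (q < psum r k).
Proof.
move=> /blkP[_ le lt]; apply/idP/idP => [bk|].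
  exact: leq_trans lt (leq_psum r bk).
by apply: contraLR; rewrite -!leqNgt => /(leq_psum r) h; apply: leq_trans h le.
Qed.

Lemma blk_eq r q (k : 'I_n) :
  psum r k <= q < psum r k.+1 -> blk r q = k.
Proof.
move=> /andP[le lt].
have qn : q < psum r n by apply: leq_trans lt (leq_psum r (ltn_ord k)).
by have := blk_lt k qn; have := blk_lt k.+1 qn; lia.
Qed.

(** If two partial sums differed at [k], the smaller one, taken as a value, would lie in a block
    before [k] for one vector only. *)
Lemma blk_inj r r' : psum r n = psum r' n ->
  (forall q, q < psum r n -> blk r q = blk r' q) -> r = r'.
Proof.
move=> en eb.
have ep k : k <= n -> psum r k = psum r' k.
  move=> kn; have := leq_psum r kn; have := leq_psum r' kn => l' l.
  have e q : q < psum r n -> (q < psum r k) = (q < psum r' k).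
    by move=> qn; rewrite -(blk_lt k qn) eb // blk_lt // -en.
  case: (ltngtP (psum r k) (psum r' k)) => // lt.
    by have := e (psum r k); lia.
  by have := e (psum r' k); lia.
apply/ffunP=> k; have := psumS r k; rewrite !ep //; last exact: ltnW.
by rewrite psumS => /addnI.
Qed.

(** The breakpoint [k i] is the first time the walk [psum r j - j] reaches level [-i]; the
    inequality says that the walk never goes below [-(n - m)]. *)
Lemma balancedP (m : nat) r : m <= n ->
  balanced m r <-> psum r n = m /\ forall j, j <= n -> j <= psum r j + (n - m).
Proof.
move=> mn; split=> [[k [[k0 kn kS] ke kl rn]]|[rn bd]].
  split=> // j jn.
  have [i [il ij ji]] : exists i, [/\ i <= n - m, k i <= j & j < k i.+1].
    have : j < k (n - m).+1 by rewrite kn.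
    elim: {1 3}(n - m) (leqnn (n - m)) => [|d IH] dl jl; first by exists 0; rewrite k0.
    have [jd|dj] := ltnP j (k d.+1); last by exists d.+1.
    by apply: IH jd; apply: ltnW.
  have [e|ne] := eqVneq j (k i); last by have := kl i j il; lia.
  case: i e {ij ji} il => [|i] e il; first by rewrite e k0.
  by have := ke i.+1; rewrite -e; lia.
(* If no [j <= n] qualifies, [find] returns [n.+1], the value prescribed for [k (n - m).+1]. *)
pose k i := find (fun j => psum r j + i <= j) (iota 0 n.+1).
have k_le i j : j <= n -> psum r j + i <= j -> k i <= j.
  move=> jn pj; rewrite leqNgt; apply/negP => /(before_find 0).
  by rewrite nth_iota ?ltnS // add0n pj.
have k_lt i j : j < k i -> j < psum r j + i.
  move=> jk; have := before_find 0 jk; rewrite nth_iota ?add0n; first by lia.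
  by apply: leq_trans jk _; rewrite -[n.+1 in leqRHS](size_iota 0) find_size.
have k_lek i : k i <= n -> psum r (k i) + i <= k i.
  rewrite -ltnS -[n.+1](size_iota 0) -has_find => hk.
  have := nth_find 0 hk; rewrite nth_iota //.
  by rewrite -[n.+1 in ltnRHS](size_iota 0) -has_find.
have k_en i : i <= n - m -> k i <= n.
  by move=> il; apply: k_le; lia.
(* the walk [psum r j - j] has down-steps of size at most one *)
have k_eq i : i <= n - m -> psum r (k i) + i = k i.
  move=> il; apply/eqP; rewrite eqn_leq k_lek ?k_en //=.
  case e: (k i) => [|j] //; have := k_lt i j; rewrite e => /(_ (leqnn _)).
  by have := leq_psum r (leqnSn j); lia.
have kE : k (n - m).+1 = n.+1.
  apply/eqP; rewrite eqn_leq -{1}[n.+1](size_iota 0) find_size leqNgt ltnS.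
  apply/negP => /[dup] kn /k_lek; have := bd _ kn; lia.
exists k; split=> //.
- split=> // [|i il]; first by apply/eqP; rewrite -leqn0 k_le ?psum0.
  have := k_en _ il; have [il'|] := ltnP i (n - m); last first.
    by move=> ? ?; have -> : i = n - m; [lia | rewrite kE ltnS k_en].
  move=> _; have := k_eq _ il'; have := k_en _ il'.
  case e: (k i.+1) => [|j] jn pj; first by lia.
  rewrite ltnS k_le //; first exact: ltnW.
  by have := leq_psum r (leqnSn j); lia.
- by move=> i /andP[_ /k_eq]; lia.
- move=> i j il /andP[ij /k_lt]; have := k_eq _ il; lia.
Qed.

End Blocks.

Lemma pairwise_ltn_ord (m : nat) (P : rel 'I_m) (s : seq 'I_m) :
  pairwise (fun i j : 'I_m => i < j) s ->
  pairwise P s <-> {in s &, forall i j : 'I_m, i < j -> P i j}.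
Proof.
elim: s => [|a s IH] //= /andP[/allP as_ ps]; split.
  move=> /andP[/allP aP /IH H] i j; rewrite !inE.
  case/predU1P=> [->|si] /predU1P[->|sj]; rewrite ?ltnn //; auto.
  - by have := as_ _ si; lia.
  - exact: H.
move=> H; apply/andP; split.
  by apply/allP=> j sj; apply: H; rewrite ?inE ?eqxx ?sj ?orbT //; apply: as_.
by apply/IH => // i j si sj; apply: H; rewrite !inE ?si ?sj orbT.
Qed.

(** The word has no repeated letter, so the interval is a subsequence exactly when the subword on
    its letters equals it, that is, when this subword is increasing. *)
Lemma subseq_word (m : nat) (sigma : 'S_m) (a l : nat) : a + l <= m ->
  subseq (iota a.+1 l) (word sigma) <->
  forall i j : 'I_m, a <= sigma i < a + l -> a <= sigma j < a + l ->
    i < j -> sigma i < sigma j.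
Proof.
move=> alm.
have uw : uniq (word sigma).
  by rewrite map_inj_uniq ?enum_uniq // => i j [] /val_inj/perm_inj.
have mw c : c < m -> c.+1 \in word sigma.
  move=> cm; apply/mapP; exists (sigma^-1 (Ordinal cm))%g; rewrite ?mem_enum //.
  by rewrite permKV.
pose s := [seq i <- enum 'I_m | (sigma i).+1 \in iota a.+1 l].
have ew : [seq x <- word sigma | x \in iota a.+1 l] = [seq (sigma i).+1 | i <- s].
  by rewrite filter_map.
have mem_s i : (i \in s) = (a <= sigma i < a + l).
  by rewrite mem_filter mem_enum andbT mem_iota ltnS.
have ps : pairwise (fun i j : 'I_m => i < j) s.
  apply: pairwise_filter; rewrite -(pairwise_map (@nat_of_ord m) ltn) val_enum_ord.
  by rewrite -(sorted_pairwise ltn_trans) iota_ltn_sorted.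
have -> : subseq (iota a.+1 l) (word sigma) =
          sorted ltn [seq (sigma i).+1 | i <- s].
  apply/(subseq_uniqP uw)/idP => [e|so].
    by rewrite -ew -e iota_ltn_sorted.
  apply: (irr_sorted_eq ltn_trans ltnn) => //; first exact: iota_ltn_sorted.
    by rewrite ew.
  move=> x; rewrite mem_filter; case xi: (x \in iota a.+1 l) => //=.
  by move: xi; rewrite mem_iota; case: x => // x xi; rewrite mw //; lia.
rewrite sorted_pairwise ?pairwise_map; last exact: ltn_trans.
rewrite pairwise_ltn_ord //; split=> H i j.
  by rewrite -!mem_s => si sj; apply: H.
by rewrite !mem_s => si sj; apply: H.
Qed.

Lemma compatibleP (n m : nat) (r : {ffun 'I_n -> nat}) (sigma : 'S_m) :
  psum r n = m ->
  compatible r sigma <-> forall i j : 'I_m,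
    blk r (sigma i) = blk r (sigma j) -> i < j -> sigma i < sigma j.
Proof.
move=> rn.
have bl (k : 'I_n) : psum r k + r k <= m by rewrite -psumS -rn leq_psum.
split=> [H i j eb|H k].
  have [bn le lt] : [/\ blk r (sigma i) < n, psum r (blk r (sigma i)) <= sigma i
    & sigma i < psum r (blk r (sigma i)).+1] by apply: blkP; rewrite rn.
  have [_ le' lt'] : [/\ blk r (sigma j) < n, psum r (blk r (sigma j)) <= sigma j
    & sigma j < psum r (blk r (sigma j)).+1] by apply: blkP; rewrite rn.
  have := (subseq_word _ (bl (Ordinal bn))).1 (H (Ordinal bn)).
  by rewrite -psumS /=; apply; rewrite ?le // eb le'.
apply/subseq_word=> // i j; rewrite -psumS => /blk_eq ei /blk_eq ej.
by apply: H; rewrite ei ej.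
Qed.

(** * Breadth-first order *)

Lemma ltn_card_lower (T : finType) (c : T -> nat) (x y : T) :
  (#|[pred z | c z < c x]| < #|[pred z | c z < c y]|) = (c x < c y).
Proof.
have mono u v : c u <= c v -> #|[pred z | c z < c u]| <= #|[pred z | c z < c v]|.
  move=> uv; apply/subset_leq_card/fintype.subsetP => z; rewrite !inE => zu.
  exact: leq_trans zu uv.
case: (leqP (c y) (c x)) => xy; first by rewrite ltnNge mono.
apply: (@leq_trans #|[pred z | c z <= c x]|); last first.
  apply/subset_leq_card/fintype.subsetP => z; rewrite !inE => zx.
  exact: leq_ltn_trans zx xy.
apply/proper_card/properP; split; first by apply/fintype.subsetP => z /[!inE] /ltnW.
by exists x; rewrite !inE ?leqnn ?ltnn.
Qed.

(** Standardization: [sigma p] is the rank of [c p] among the values of [c]. *)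
Lemma perm_of_injective (m : nat) (c : 'I_m -> nat) : injective c ->
  exists sigma : 'S_m, forall p q, (sigma p < sigma q) = (c p < c q).
Proof.
move=> cI.
have rm p : #|[pred z | c z < c p]| < m.
  rewrite -[ltnRHS]card_ord; apply/proper_card/properP.
  by split; [apply/fintype.subsetP | exists p; rewrite !inE ?ltnn].
have sI : injective (fun p => Ordinal (rm p)).
  move=> p q /(congr1 val) /= e; apply: cI.
  by case: (ltngtP (c p) (c q)) => //; rewrite -(ltn_card_lower c) e ltnn.
by exists (perm sI) => p q; rewrite !permE /= ltn_card_lower.
Qed.

Lemma perm_card_lt (m : nat) (sigma : 'S_m) (p : 'I_m) :
  #|[pred q | sigma q < sigma p]| = sigma p.
Proof.
rewrite -sum1_card.
transitivity (\sum_(q < m | q < sigma p) 1).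
  by rewrite [RHS](reindex_perm sigma).
by rewrite -(big_ord_widen m (fun=> 1)) ?sum1_card ?card_ord // ltnW.
Qed.

(** Recursion from the roots along the parent map, with the height as fuel. *)
Lemma ranked_rec (V : finType) (R : {set V}) (T : Type) (g : V -> V) (h : V -> nat)
    (base : V -> T) (step : V -> T -> T) : ranked R g h ->
  exists u : V -> T, (forall x, x \in R -> u x = base x) /\
    (forall x, x \notin R -> u x = step x (u (g x))).
Proof.
move=> rk.
(* With fuel at least [h x], fuel 0 occurs only at a root, as a non-root has positive height; so
   [base x] is the right value there. *)
pose fix code k x {struct k} := if k is k'.+1 then
  if x \in R then base x else step x (code k' (g x)) else base x.
have codeE k l x : h x <= k -> h x <= l -> code k x = code l x.
  elim: k l x => [|k IH] [|l] x //= hk hl; case: ifPn => // /rk ?; try by lia.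
  by rewrite (IH l) //; lia.
pose B := \max_x h x.
have hB x : h x <= B by apply: leq_bigmax.
exists (code B); split=> x xR; first by case: (B) => //= b; rewrite xR.
by rewrite (codeE B B.+1) ?(leqW (hB _)) //= (negPf xR).
Qed.

Section BreadthFirst.
Variables (V : finType) (R : {set V}) (n m : nat) (nr : 'I_m -> V).
Hypothesis nr_inj : injective nr.
Hypothesis nrP : forall x, reflect (exists p, x = nr p) (x \notin R).
Implicit Types (g : V -> V) (u : V -> nat) (x y : V) (p q : 'I_m).
Implicit Types (r : {ffun 'I_n -> nat}) (sigma : 'S_m).

Let nrR p : (nr p \in R) = false.
Proof. by apply/negbTE/nrP; exists p. Qed.

(* Positions in the queue, counted from 0. *)
Definition posn sigma x : nat :=
  if [pick p | nr p == x] is Some p then #|R| + sigma p else index x (enum R).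

Lemma posn_nr sigma p : posn sigma (nr p) = #|R| + sigma p.
Proof.
rewrite /posn; case: pickP => [q /eqP/nr_inj -> //|/(_ p)].
by rewrite eqxx.
Qed.

Lemma posn_root sigma x : x \in R -> posn sigma x = index x (enum R).
Proof.
by move=> xR; rewrite /posn; case: pickP => // q /eqP e; rewrite -e nrR in xR.
Qed.

Lemma posn_rootP sigma x : (posn sigma x < #|R|) = (x \in R).
Proof.
have [xR|/nrP[p ->]] := boolP (x \in R); last by rewrite posn_nr; lia.
by rewrite posn_root // cardE index_mem mem_enum.
Qed.

Lemma posn_inj sigma : injective (posn sigma).
Proof.
move=> x y e; have := posn_rootP sigma x; rewrite e posn_rootP.
have [xR|/nrP[p ex]] := boolP (x \in R) => yR; move: e.
  by rewrite !posn_root //; apply: (index_inj x); rewrite mem_enum.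
move/negbT/nrP: yR => [q ->]; rewrite ex !posn_nr => /addnI/val_inj.
by move/perm_inj => ->.
Qed.

Lemma posn_surj sigma k : k < #|R| + m -> exists x, posn sigma x = k.
Proof.
move=> km; have [kR|Rk] := ltnP k #|R|.
  exists (enum_val (Ordinal kR)); rewrite posn_root ?enum_valP //.
  by rewrite index_uniq ?enum_uniq // -cardE.
have km' : k - #|R| < m by lia.
by exists (nr (sigma^-1 (Ordinal km'))%g); rewrite posn_nr permKV /=; lia.
Qed.

(** Meant for non-roots: at a root the truncated subtraction gives an arbitrary vertex, and parent
    maps are compared only outside [R]. *)
Definition parent r sigma x : V :=
  odflt x [pick y | posn sigma y == blk r (posn sigma x - #|R|)].

(** The queue order of [g] described by comparisons alone, so that queue positions and path numerals
    can both satisfy it. *)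
Definition bfs_order g u : Prop :=
  [/\ {in R &, forall x y, (u x < u y) = (index x (enum R) < index y (enum R))},
      forall x p, x \in R -> u x < u (nr p),
      forall p q, (u (nr p) < u (nr q)) =
        (u (g (nr p)) < u (g (nr q))) || ((u (g (nr p)) == u (g (nr q))) && (p < q))
    & ranked R g u].

(** The clauses decide a comparison of two non-roots from that of their parents, which come earlier;
    injectivity of [u] turns a tie into equal parents. Hence the queue order is unique. *)
Lemma bfs_order_mono g u u' : injective u ->
  bfs_order g u -> bfs_order g u' -> {homo id : x y / u x < u y >-> u' x < u' y}.
Proof.
move=> uI [rr rn nn rk] [rr' rn' nn' _] x y.
have [k] := ubnP (u y); elim: k x y => // k IH x y yk.
have [yR|/nrP[q ey]] := boolP (y \in R).
  have [xR|/nrP[p ->]] := boolP (x \in R); first by rewrite rr // rr'.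
  by have := rn y p yR; lia.
have [xR|/nrP[p ex]] := boolP (x \in R); first by rewrite ey rn'.
rewrite ex ey nn nn' => /orP[lt|/andP[/eqP/uI -> ->]]; last by rewrite eqxx orbT.
rewrite IH //; apply: leq_trans (rk _ _) _; first by rewrite nrR.
by rewrite -ey.
Qed.

Lemma bfs_order_exists g h : ranked R g h -> exists u, injective u /\ bfs_order g u.
Proof.
move=> rk.
(* u x is the base-N numeral whose digits spell the path from the root to x. *)
pose N := (#|R| + m).+1.
(* Digits below [m] are the labels of non-roots; the next [#|R|] digits are the roots in enumeration
   order. *)
pose digit x := if [pick p | nr p == x] is Some p then nat_of_ord p
                else m + index x (enum R).
have digit_nr p : digit (nr p) = p.
  by rewrite /digit; case: pickP => [q /eqP/nr_inj -> //|/(_ p)]; rewrite eqxx.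
have digit_root x : x \in R -> digit x = m + index x (enum R).
  by move=> xR; rewrite /digit; case: pickP => // q /eqP e; rewrite -e nrR in xR.
have idx x : x \in R -> index x (enum R) < #|R|.
  by move=> xR; rewrite cardE index_mem mem_enum.
have digit_lt x : digit x < N.
  have [xR|/nrP[p ->]] := boolP (x \in R).
    by rewrite digit_root // /N; have := idx x xR; lia.
  by rewrite digit_nr /N; have := ltn_ord p; lia.
have digit_inj : injective digit.
  move=> x y.
  have [xR|/nrP[p ->]] := boolP (x \in R); have [yR|/nrP[q ->]] := boolP (y \in R).
  - rewrite !digit_root // => /addnI; apply: (index_inj x); by rewrite mem_enum.
  - by rewrite digit_root // digit_nr; have := ltn_ord q; lia.
  - by rewrite digit_nr digit_root //; have := ltn_ord p; lia.
  - by rewrite !digit_nr => /val_inj ->.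
(* The leading digit 1 in [N + digit x] makes every numeral nonzero: appending a digit then
   increases it strictly, and every non-root exceeds every root. *)
have [u [u_R u_step]] := ranked_rec (fun x => N + digit x) (fun x c => c * N + digit x) rk.
have u_root x : x \in R -> u x = N + digit x by apply: u_R.
have u_nr p : u (nr p) = u (g (nr p)) * N + p by rewrite u_step ?nrR // digit_nr.
have u_ge x : N <= u x.
  have [k] := ubnP (h x); elim: k x => // k IH x hx.
  have [xR|xR] := boolP (x \in R); first by rewrite u_root // leq_addr.
  rewrite u_step //; have /IH : h (g x) < k by have := rk x xR; lia.
  by have : 0 < N by []; nia.
(* The last digit names the vertex itself, whence the injectivity of [u]. *)
have u_mod x : u x %% N = digit x.
  have [xR|/nrP[p ->]] := boolP (x \in R).
    by rewrite u_root // modnDl modn_small.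
  by rewrite u_nr digit_nr modnMDl modn_small //; have := digit_lt (nr p); rewrite digit_nr.
have p_lt p : p < N by rewrite /N; have := ltn_ord p; lia.
exists u; split; first by move=> x y e; apply: digit_inj; rewrite -!u_mod e.
split.
- by move=> x y xR yR; rewrite !u_root // !digit_root // !ltn_add2l.
- move=> x p xR; rewrite u_root // u_nr; have := u_ge (g (nr p)).
  have := digit_lt x; have := p_lt p; have : 1 < N by rewrite /N; have := ltn_ord p; lia.
  nia.
- move=> p q; rewrite !u_nr; have := p_lt p; have := p_lt q.
  by case: (ltngtP (u (g (nr p))) (u (g (nr q)))) => [| |->] /=; nia.
- move=> x /nrP[p ->]; rewrite u_nr; have := u_ge (g (nr p)).
  have : 1 < N by rewrite /N; have := ltn_ord p; lia.
  nia.
Qed.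

(** The second clause is the balanced bound for [#|R| = (n - m) + 1]: once [j] vertices are served,
    [#|R| + psum r j] have entered the queue, so one is still waiting. *)
Definition parking r sigma : Prop :=
  [/\ psum r n = m, forall j, j <= n -> j < psum r j + #|R|
    & forall p q, blk r (sigma p) = blk r (sigma q) -> p < q -> sigma p < sigma q].

(** * Compatible balanced pairs and breadth-first orders *)

Hypothesis card_V : n.+1 = #|R| + m.

Lemma posn_parent r sigma p : parking r sigma ->
  posn sigma (parent r sigma (nr p)) = blk r (sigma p).
Proof.
case=> rn _ _; rewrite /parent posn_nr addKn; case: pickP => [y /eqP //|].
have [bn _ _] : [/\ blk r (sigma p) < n, psum r (blk r (sigma p)) <= sigma p
    & sigma p < psum r (blk r (sigma p)).+1] by apply: blkP; rewrite rn.
have [|x ex] := @posn_surj sigma (blk r (sigma p)); first by rewrite -card_V ltnW.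
by move/(_ x); rewrite ex eqxx.
Qed.

(** Blocks follow each other in queue order, so children are ordered by parent; inside a block
    compatibility orders them by label. The balanced bound at [j = blk r (sigma p)] puts the parent
    before the child. *)
Lemma parking_bfs r sigma :
  parking r sigma -> bfs_order (parent r sigma) (posn sigma).
Proof.
move=> park; have [rn bd cp] := park.
have sl p : sigma p < psum r n by rewrite rn.
split.
- by move=> x y xR yR; rewrite !posn_root.
- by move=> x p xR; rewrite posn_nr ltn_addr // posn_rootP.
- move=> p q; rewrite !posn_parent // !posn_nr ltn_add2l.
  have [bp lp gp] := blkP (sl p); have [bq lq gq] := blkP (sl q).
  case: (ltngtP (blk _ (sigma p)) (blk _ (sigma q))) => [lt|lt|e] /=.
  + by have := leq_psum r lt; lia.
  + by have := leq_psum r lt; lia.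
  + have [pq|qp|/val_inj ->] := ltngtP p q; last by rewrite ltnn.
    * by rewrite cp.
    * by have := cp _ _ (esym e) qp; lia.
- move=> x /nrP[p ->]; rewrite posn_parent // posn_nr.
  by have [bp lp _] := blkP (sl p); have := bd _ (ltnW bp); lia.
Qed.

(** The parent map fixes the queue order, hence [sigma] by ranks; the blocks are then the positions
    of the parents and fix [r]. *)
Lemma parking_inj r sigma r' sigma' : parking r sigma -> parking r' sigma' ->
  {in ~: R, parent r sigma =1 parent r' sigma'} -> (r, sigma) = (r', sigma').
Proof.
move=> park park' eg.
have bfs := parking_bfs park; have bfs' := parking_bfs park'.
have {}bfs' : bfs_order (parent r sigma) (posn sigma').
  case: bfs' => rr rn nn rk; split=> //.
    by move=> p q; rewrite !eg ?inE ?nrR.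
  by move=> x xR; rewrite eg ?inE //; apply: rk.
have lt x y : (posn sigma x < posn sigma y) = (posn sigma' x < posn sigma' y).
  apply/idP/idP; first exact: (bfs_order_mono (@posn_inj _) bfs bfs').
  exact: (bfs_order_mono (@posn_inj _) bfs' bfs).
have es : sigma = sigma'.
  apply/permP => p; apply/val_inj; rewrite /= -(perm_card_lt sigma) -(perm_card_lt sigma').
  apply: eq_card => q.
  by have := lt (nr q) (nr p); rewrite !posn_nr !ltn_add2l.
rewrite -es in park' eg *; congr (_, _).
have [rn _ _] := park; have [rn' _ _] := park'.
apply: blk_inj; rewrite ?rn ?rn' // => q qm.
have -> : q = sigma (sigma^-1 (Ordinal qm))%g by rewrite permKV.
by rewrite -!posn_parent // eg // inE nrR.
Qed.

(** Take for [sigma] the ranks of the non-roots under [u], and for [r] the numbers of children in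
    queue order. *)
Lemma bfs_parking g u : injective u -> bfs_order g u ->
  exists r sigma, parking r sigma /\ {in ~: R, parent r sigma =1 g}.
Proof.
move=> uI [rr rnr nn rk].
have [|sigma sE] := @perm_of_injective m (u \o nr); first exact: inj_comp uI nr_inj.
have lt x y : (posn sigma x < posn sigma y) = (u x < u y).
  have [xR|/nrP[p ->]] := boolP (x \in R); have [yR|/nrP[q ->]] := boolP (y \in R).
  - by rewrite !posn_root // rr.
  - by rewrite rnr // posn_nr ltn_addr // posn_rootP.
  - by have := rnr y p yR; have := posn_rootP sigma y; rewrite yR posn_nr; lia.
  - by rewrite !posn_nr ltn_add2l sE.
have up p : posn sigma (g (nr p)) < #|R| + sigma p.
  by rewrite -posn_nr lt rk // nrR.
(* A parent precedes its child, so it is never the last of the [n.+1] queue positions; this is why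
   [r] has only [n] entries. *)
have bn p : posn sigma (g (nr p)) < n.
  by have := up p; have := ltn_ord (sigma p); lia.
pose b p := Ordinal (bn p).
have lt_s p q : (sigma p < sigma q) = (b p < b q) || ((b p == b q :> nat) && (p < q)).
  rewrite sE /= nn !lt; congr (_ || (_ && _)).
  by apply/eqP/eqP => [/uI ->|/posn_inj ->].
pose r := [ffun k => #|[pred p | b p == k]|].
have psumE k : psum r k = #|[pred p | b p < k]|.
  rewrite /psum -sum1_card (partition_big b (fun s : 'I_n => s < k)) //=.
  apply: eq_bigr => s sk; rewrite ffunE -sum1_card; apply: eq_bigl => p.
  apply/eqP/andP => [e|[_ /eqP] //]; split; last exact/eqP.
  by move: sk; rewrite -e.
(* The letters whose parent comes before that of [p] precede [p], and every letter up to [p] has its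
   parent no later than that of [p]; so [sigma p] falls in the block of its parent. *)
have blkE p : blk r (sigma p) = b p.
  apply: blk_eq; rewrite !psumE -{1 2}(perm_card_lt sigma p); apply/andP; split.
    apply/subset_leq_card/fintype.subsetP => q; rewrite !inE => bq.
    by rewrite lt_s bq.
  apply/proper_card/properP; split.
    by apply/fintype.subsetP => q; rewrite !inE lt_s /=; lia.
  by exists p; rewrite !inE ?ltnn //= ltnSn.
have rn : psum r n = m.
  by rewrite psumE -[RHS]card_ord; apply: eq_card => p; rewrite !inE ltn_ord.
have park : parking r sigma.
  split=> //.
  (* If the queue were empty after [j] vertices, the letter with value [psum r j] would have its
     parent at position at least [j], hence not before itself. *)
  - move=> j jn; rewrite ltnNge; apply/negP => le.
    have qm : psum r j < m by lia.
    pose p := (sigma^-1 (Ordinal qm))%g.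
    have sp : sigma p = psum r j :> nat by rewrite permKV.
    have := up p; rewrite -[posn _ _]/(nat_of_ord (b p)) -blkE.
    have : (blk r (sigma p) < j) = (sigma p < psum r j).
      by apply: blk_lt; rewrite rn.
    by rewrite sp ltnn; lia.
  - by move=> p q; rewrite !blkE lt_s => -> ->; rewrite eqxx orbT.
exists r, sigma; split=> // x; rewrite inE => /nrP[p ->].
by apply: (@posn_inj sigma); rewrite posn_parent // blkE.
Qed.
End BreadthFirst.

(** * The bijection between pairs and forests *)

Theorem theorem2p4 (m n : nat) (R : {set 'I_n.+1}) :
  1 <= m <= n -> #|R| = n + 1 - m ->
  exists f : {ffun 'I_n -> nat} * 'S_m -> {set {set 'I_n.+1}},
    set_bij (compatible_balanced m n) (rooted_forests (n + 1 - m) R) f.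
Proof.
move=> /andP[_ mn] cR.
have cC : #|~: R| = m by have := cardsC R; rewrite card_ord; lia.
pose nr (p : 'I_m) : 'I_n.+1 := enum_val (cast_ord (esym cC) p).
have nr_inj : injective nr by move=> p q /enum_val_inj/cast_ord_inj.
have nrP x : reflect (exists p, x = nr p) (x \notin R).
  rewrite -finset.in_setC; apply: (iffP idP) => [xR|[p ->]]; last exact: enum_valP.
  by exists (cast_ord cC (enum_rank_in xR x)); rewrite /nr cast_ordK enum_rankK_in.
have cV : n.+1 = #|R| + m by lia.
have CP x : compatible_balanced m n x <-> parking R x.1 x.2.
  rewrite /compatible_balanced /parking /= cR balancedP //; split.
    move=> [cp [rn bd]]; split=> //; last exact/compatibleP.
    by move=> j /bd; lia.
  move=> [rn bd cp]; split; first exact/compatibleP.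
  by split=> // j /bd; lia.
exists (fun x => edges R (parent R nr x.1 x.2)); split.
- move=> x /CP /(parking_bfs nr_inj nrP cV)[_ _ _ rk].
  by rewrite -cR; apply: edges_forest rk.
- move=> [r s] [r' s']; rewrite !inE => /CP park /CP park' /= e.
  apply: (parking_inj nr_inj nrP cV) => //.
  have [_ _ _ rk] := parking_bfs nr_inj nrP cV park.
  have [_ _ _ rk'] := parking_bfs nr_inj nrP cV park'.
  exact: edges_inj rk rk' e.
- move=> E /forest_edges[g [h [/(bfs_order_exists nr_inj nrP)[u [uI bfs]] ->]]].
  have [r [s [park eg]]] := bfs_parking nr_inj nrP cV uI bfs.
  exists (r, s); first exact/CP.
  by apply: eq_in_imset => x xR; rewrite /= eg.
Qed.
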